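(* For all $n\ge2$ and $P,Q\in\Gamma_n$, $$\mathcal W_s(P\Vert Q)\le h(P\Vert Q)\quad\text{for } -2\le s\le0,\qquad \mathcal W_s(P\Vert Q)\ge h(P\Vert Q)\quad\text{for } s\ge\tfrac12.$$
   Context: $\Gamma_n=\{P=(p_1,\dots,p_n): p_i>0,\ \sum_{i=1}^n p_i=1\}$. For $P,Q\in\Gamma_n$, $h(P\Vert Q)=\frac12\sum_{i=1}^n(\sqrt{p_i}-\sqrt{q_i})^2$ (Hellinger discrimination) and $$\mathcal W_s(P\Vert Q)=\begin{cases}[s(s-1)]^{-1}\left[\sum_{i=1}^n\left(\frac{p_i^{1-s}+q_i^{1-s}}{2}\right)\left(\frac{p_i+q_i}{2}\right)^s-1\right], & s\ne0,1,\\ \frac12\left[\sum_{i=1}^n p_i\ln\left(\frac{2p_i}{p_i+q_i}\right)+\sum_{i=1}^n q_i\ln\left(\frac{2q_i}{p_i+q_i}\right)\right], & s=0,\\ \sum_{i=1}^n\left(\frac{p_i+q_i}{2}\right)\ln\left(\frac{p_i+q_i}{2\sqrt{p_iq_i}}\right), & s=1.\end{cases}$$ *)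

(* Defs.v *)
From mathcomp Require Import all_boot all_order all_algebra.
From mathcomp Require Import all_classical all_reals all_analysis.

Set Implicit Arguments.
Unset Strict Implicit.
Unset Printing Implicit Defensive.

Import Order.TTheory GRing.Theory Num.Theory.

Local Open Scope ring_scope.
Local Open Scope classical_set_scope.

Definition Gamma (R : realType) (n : nat) : set ('I_n -> R) :=
  [set P | (forall i, 0 < P i) /\ \sum_(i < n) P i = 1].

Definition hellinger (R : realType) (n : nat) (P Q : 'I_n -> R) : R :=
  2^-1 * \sum_(i < n) (Num.sqrt (P i) - Num.sqrt (Q i)) ^+ 2.

(* On Gamma every base of [powR] and every argument of [ln] below is positive,
   so the values these functions take elsewhere play no role. *)
Definition W (R : realType) (n : nat) (s : R) (P Q : 'I_n -> R) : R :=
  if s == 0 then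
    2^-1 * (\sum_(i < n) P i * ln (2 * P i / (P i + Q i))
            + \sum_(i < n) Q i * ln (2 * Q i / (P i + Q i)))
  else if s == 1 then
    \sum_(i < n) (P i + Q i) / 2
                 * ln ((P i + Q i) / (2 * Num.sqrt (P i * Q i)))
  else
    (s * (s - 1))^-1
    * (\sum_(i < n) (P i `^ (1 - s) + Q i `^ (1 - s)) / 2
                    * ((P i + Q i) / 2) `^ s
       - 1).

(* Main.v *)
Require Import Defs.
From mathcomp Require Import all_boot all_order all_algebra.
From mathcomp Require Import all_classical all_reals all_analysis.
From mathcomp Require Import ring lra.

Import Order.TTheory GRing.Theory Num.Theory.
Import numFieldNormedType.Exports.

Local Open Scope ring_scope.
Local Open Scope classical_set_scope.

(** With $A_i = (p_i+q_i)/2$ and $t_i = (p_i-q_i)/(p_i+q_i)$ one has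
    $p_i = A_i(1+t_i)$ and $q_i = A_i(1-t_i)$. Both discriminations are
    homogeneous of degree one, and $\sum_i A_i = 1$, so each is a sum
    $\sum_i A_i\,\varphi(t_i)$ for an even function $\varphi$ on $]-1,1[$
    ([W_as_sum], [hellinger_as_sum]): for the Hellinger discrimination
    $\varphi(t) = 1-\sqrt{1-t^2}$, and for $W_s$
    $\varphi(t) = (F_s(1+t)+F_s(1-t))/2$, where $F_s''(x) = x^{-s-1}$.

    It therefore suffices to compare the two profiles. Both vanish at $0$ with
    their first derivatives, so it is enough to compare second derivatives
    ([ge0_of_derive2_ge0]), and these need no case distinction at $s = 0, 1$:
    they are $((1+t)^{-s-1}+(1-t)^{-s-1})/2$ and $(1-t^2)^{-3/2}$.

    For $-2\le s\le 0$ the exponent lies in $[-1,1]$, and tangent line bounds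
    give at most $(1-t^2)^{-1}\le(1-t^2)^{-3/2}$ ([even_powR_le]). For
    $s\ge 1/2$ put $c = s+1\ge 3/2$. The mean of $(1\pm t)^{-c}$ is the mean
    of $(1\pm t)^{c}$, which is at least $1$, divided by $(1-t^2)^{c}$, which
    is at most $(1-t^2)^{3/2}$ ([even_powR_ge]). *)

(** * Comparison through second derivatives *)

Lemma ge0_of_derive2_ge0 {R : realType} (f f1 f2 : R -> R) :
  (forall t : R, 0 <= t -> t < 1 -> is_derive t 1 f (f1 t)) ->
  (forall t : R, 0 <= t -> t < 1 -> is_derive t 1 f1 (f2 t)) ->
  f 0 = 0 -> f1 0 = 0 -> (forall t, 0 <= t -> t < 1 -> 0 <= f2 t) ->
  forall t, 0 <= t -> t < 1 -> 0 <= f t.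
Proof.
have step (g g1 : R -> R) :
  (forall t : R, 0 <= t -> t < 1 -> is_derive t 1 g (g1 t)) ->
  g 0 = 0 -> (forall t, 0 <= t -> t < 1 -> 0 <= g1 t) ->
  forall t, 0 <= t -> t < 1 -> 0 <= g t.
  move=> dg g0 g1_ge0 t t0 t1.
  have [||c] := @MVT_segment R g g1 0 t t0.
  - by move=> x; rewrite in_itv/= => /andP[x0 xt]; apply: dg; lra.
  - apply: derivable_within_continuous => x.
    rewrite in_itv/= => /andP[x0 xt].
    by apply: (@ex_derive _ _ _ _ _ _ _ (dg _ _ _)); lra.
  - rewrite in_itv/= => /andP[c0 ct].
    rewrite g0 !subr0 => ->; apply: mulr_ge0 => //.
    apply: g1_ge0; lra.
move=> df df1 f0 f10 f2_ge0.
exact: (step f f1 df f0 (step f1 f2 df1 f10 f2_ge0)).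
Qed.

(** * Even and odd parts about 1 *)

Definition even_about1 {R : realType} (f : R -> R) (t : R) : R :=
  (f (1 + t) + f (1 - t)) / 2.

Definition odd_about1 {R : realType} (f : R -> R) (t : R) : R :=
  (f (1 + t) - f (1 - t)) / 2.

Lemma is_derive_even_about1 {R : realType} (f f1 : R -> R) (t : R) :
  (forall x : R, 0 < x -> is_derive x 1 f (f1 x)) -> -1 < t -> t < 1 ->
  is_derive t 1 (even_about1 f) (odd_about1 f1 t).
Proof.
move=> df t_gtN1 t_lt1.
have dp : is_derive (1 + t) 1 f (f1 (1 + t)) by apply: df; lra.
have dm : is_derive (1 - t) 1 f (f1 (1 - t)) by apply: df; lra.
have cp := @is_derive1_comp _ f (fun t => 1 + t) _ _ _ dp _.
have cm := @is_derive1_comp _ f (fun t => 1 - t) _ _ _ dm _.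
by apply: is_derive_eq; rewrite /odd_about1 /GRing.scale/=; field.
Qed.

Lemma is_derive_odd_about1 {R : realType} (f f1 : R -> R) (t : R) :
  (forall x : R, 0 < x -> is_derive x 1 f (f1 x)) -> -1 < t -> t < 1 ->
  is_derive t 1 (odd_about1 f) (even_about1 f1 t).
Proof.
move=> df t_gtN1 t_lt1.
have dp : is_derive (1 + t) 1 f (f1 (1 + t)) by apply: df; lra.
have dm : is_derive (1 - t) 1 f (f1 (1 - t)) by apply: df; lra.
have cp := @is_derive1_comp _ f (fun t => 1 + t) _ _ _ dp _.
have cm := @is_derive1_comp _ f (fun t => 1 - t) _ _ _ dm _.
by apply: is_derive_eq; rewrite /even_about1 /GRing.scale/=; field.
Qed.

(** * The two profiles and their derivatives *)

Definition hellinger_profile {R : realType} (t : R) : R :=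
  1 - Num.sqrt (1 - t ^+ 2).

Lemma is_derive_hellinger_profile {R : realType} (t : R) : -1 < t -> t < 1 ->
  is_derive t 1 hellinger_profile (t / Num.sqrt (1 - t ^+ 2)).
Proof.
move=> ? ?.
have r0 : 0 < 1 - t ^+ 2 by nra.
have sr0 : Num.sqrt (1 - t ^+ 2) != 0 by rewrite gt_eqF// sqrtr_gt0.
have h :=
  @is_derive1_comp _ _ (fun t => 1 - t ^+ 2) _ _ _ (is_derive1_sqrt r0) _.
apply: is_derive_eq; rewrite /GRing.scale/=; field.
exact: sr0.
Qed.

Lemma is_derive2_hellinger_profile {R : realType} (t : R) : -1 < t -> t < 1 ->
  is_derive t 1 (fun t => t / Num.sqrt (1 - t ^+ 2))
    (Num.sqrt (1 - t ^+ 2) ^- 3).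
Proof.
move=> ? ?.
have r0 : 0 < 1 - t ^+ 2 by nra.
have sr0 : Num.sqrt (1 - t ^+ 2) != 0 by rewrite gt_eqF// sqrtr_gt0.
have h :=
  @is_derive1_comp _ _ (fun t => 1 - t ^+ 2) _ _ _ (is_derive1_sqrt r0) _.
have h2 := @is_deriveV _ (Num.sqrt \o (fun t => 1 - t ^+ 2)) t _ _ sr0 (h _ _).
apply: is_derive_eq; rewrite /GRing.scale/=.
have := sqr_sqrtr (ltW r0).
move: (Num.sqrt _) sr0 => r r_neq0 r2.
(* 1 = r^2 + t^2 turns the goal into an identity in independent r and t *)
have -> : r ^- 3 = (r ^+ 2 + t ^+ 2) / r ^+ 3 by rewrite r2 subrK mul1r.
by field.
Qed.

(** The second antiderivative of [x `^ (- s - 1)] vanishing at [1], chosen up to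
    a multiple of [x - 1], whose even part about [1] is zero. *)
Definition entropy_gen {R : realType} (s x : R) : R :=
  if s == 0 then x * ln x
  else if s == 1 then - ln x
  else (x `^ (1 - s) - 1) / (s * (s - 1)).

Definition entropy_gen_deriv {R : realType} (s x : R) : R :=
  if s == 0 then ln x + 1 else - x `^ (- s) / s.

Lemma is_derive_entropy_gen {R : realType} (s x : R) : 0 < x ->
  is_derive x 1 (entropy_gen s) (entropy_gen_deriv s x).
Proof.
move=> x0; rewrite /entropy_gen /entropy_gen_deriv.
have dln := is_derive1_ln x0.
have dpow := is_derive1_powR (1 - s) x0.
have [s0|s0] := eqVneq s 0.
  apply: is_derive_eq; rewrite /GRing.scale/=; field.
  by rewrite gt_eqF.
have [s1|s1] := eqVneq s 1.
  apply: is_derive_eq; rewrite s1 powR_inv1 ?ltW// divr1//.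
have s1' : s - 1 != 0 by rewrite subr_eq0.
apply: is_derive_eq; rewrite /GRing.scale/=.
have -> : 1 - s - 1 = - s by lra.
by field; rewrite s0 s1'.
Qed.

Lemma is_derive2_entropy_gen {R : realType} (s x : R) : 0 < x ->
  is_derive x 1 (entropy_gen_deriv s) (x `^ (- s - 1)).
Proof.
move=> x0; rewrite /entropy_gen_deriv.
have dln := is_derive1_ln x0.
have dpow := is_derive1_powR (- s) x0.
have [s0|s0] := eqVneq s 0.
  apply: is_derive_eq; rewrite s0 oppr0 sub0r powR_inv1 ?ltW// addr0//.
apply: is_derive_eq; rewrite /GRing.scale/=.
by field.
Qed.

(** * Bounds on the second derivatives *)

(** Convexity of the exponential between [ln x] and [0], with weight [b]. *)
Lemma powR_le_tangent {R : realType} (b x : R) :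
  0 <= b -> b <= 1 -> 0 < x -> x `^ b <= 1 + b * (x - 1).
Proof.
move=> b0 b1 x0.
have := @convex_expR R (Itv01 b0 b1) (ln x) 0.
rewrite !convRE /= expR0 lnK ?posrE// mulr0 addr0 mulr1 /unstable.onem.
rewrite /powR gt_eqF// => /le_trans; apply; lra.
Qed.

(** The previous bound for the exponent [c^-1] at the point [x `^ c]. *)
Lemma powR_ge_tangent {R : realType} (c x : R) :
  1 <= c -> 0 < x -> 1 + c * (x - 1) <= x `^ c.
Proof.
move=> c1 x0; have c0 : 0 < c by lra.
have := @powR_le_tangent R c^-1 (x `^ c) _ _ (powR_gt0 _ x0).
rewrite invr_ge0 (ltW c0) invf_le1// c1 -powRrM mulfV ?gt_eqF//.
rewrite (powRr1 (ltW x0)).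
move=> /(_ isT isT) h.
have := ler_wpM2l (ltW c0) h.
rewrite mulrDr mulrA mulfV ?gt_eqF//; lra.
Qed.

(** For [0 <= b] the tangent lines at [1] of the two powers add up to [2]. For
    [b < 0] the tangent bound is applied to the inverses [(1 + t)^-1] and
    [(1 - t)^-1], whose mean is [(1 - t ^+ 2)^-1]. *)
Lemma even_powR_le {R : realType} (b t : R) :
  -1 <= b -> b <= 1 -> 0 <= t -> t < 1 ->
  even_about1 (fun x => x `^ b) t <= Num.sqrt (1 - t ^+ 2) ^- 3.
Proof.
move=> bge ble t0 t1; rewrite /even_about1.
have r2_gt0 : 0 < 1 - t ^+ 2 by nra.
have r_gt0 : 0 < Num.sqrt (1 - t ^+ 2) by rewrite sqrtr_gt0.
have r2 := sqr_sqrtr (ltW r2_gt0).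
have le1 : Num.sqrt (1 - t ^+ 2) <= 1 by nra.
apply: (@le_trans _ _ (1 - t ^+ 2)^-1); last first.
  rewrite lef_pV2 ?posrE ?exprn_gt0// -{2}r2 exprS.
  by rewrite -[leRHS]mul1r ler_pM2r// exprn_gt0.
have p0 : 0 < 1 + t by lra.
have m0 : 0 < 1 - t by lra.
have i1 : 1 <= (1 - t ^+ 2)^-1 by rewrite invf_ge1//; nra.
have [b0|b0] := leP 0 b.
  have := @powR_le_tangent R b _ b0 ble p0.
  have := @powR_le_tangent R b _ b0 ble m0.
  lra.
have e x : 0 < x -> x `^ b <= 1 + (- b) * (x^-1 - 1).
  move=> x0.
  have -> : x `^ b = x^-1 `^ (- b).
    by rewrite -(powR_inv1 (ltW x0)) -powRrM mulN1r opprK.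
  by apply: powR_le_tangent; rewrite ?invr_gt0//; lra.
have := e _ p0; have := e _ m0.
have : (1 - t)^-1 + (1 + t)^-1 = 2 * (1 - t ^+ 2)^-1.
  by field; rewrite ?gt_eqF//.
nra.
Qed.

(** The tangent lines give [2 <= (1 + t) `^ c + (1 - t) `^ c]; dividing by
    [(1 - t ^+ 2) `^ c] yields the mean of the negative powers. The threshold
    [3 / 2] is the exponent of [1 - t ^+ 2] on the left. *)
Lemma even_powR_ge {R : realType} (c t : R) :
  3 / 2 <= c -> 0 <= t -> t < 1 ->
  Num.sqrt (1 - t ^+ 2) ^- 3 <= even_about1 (fun x => x `^ (- c)) t.
Proof.
move=> cge t0 t1; rewrite /even_about1.
have r2_gt0 : 0 < 1 - t ^+ 2 by nra.
have p0 : 0 < 1 + t by lra.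
have m0 : 0 < 1 - t by lra.
have c1 : 1 <= c by lra.
have xp := powR_gt0 c p0; have xm := powR_gt0 c m0.
have hp := powR_ge_tangent _ _ c1 p0.
have hm := powR_ge_tangent _ _ c1 m0.
have e : (1 + t) `^ c * (1 - t) `^ c = (1 - t ^+ 2) `^ c.
  by rewrite -powRM ?ltW//; congr (_ `^ _); ring.
apply: (@le_trans _ _ ((1 - t ^+ 2) `^ c)^-1).
  rewrite -(powR12_sqrt (ltW r2_gt0)) -(powR_mulrn 3 (powR_ge0 _ _)) -powRrM.
  rewrite lef_pV2 ?posrE ?powR_gt0//.
  by apply: ger_powR; [apply/andP; split => //; nra|lra].
rewrite !powRN -e.
have -> : ((1 + t) `^ c)^-1 + ((1 - t) `^ c)^-1 =
   ((1 + t) `^ c + (1 - t) `^ c) * ((1 + t) `^ c * (1 - t) `^ c)^-1.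
  by field; rewrite ?gt_eqF.
have i0 : 0 < ((1 + t) `^ c * (1 - t) `^ c)^-1 by rewrite invr_gt0 mulr_gt0.
nra.
Qed.

(** * Comparison of the profiles *)

Lemma entropy_gen_at1 {R : realType} (s : R) : entropy_gen s 1 = 0.
Proof.
by rewrite /entropy_gen ln1 powR1 subrr mulr0 mul0r oppr0 !if_same.
Qed.

Lemma entropy_profile_le_hellinger {R : realType} (s t : R) :
  -2 <= s -> s <= 0 -> 0 <= t -> t < 1 ->
  even_about1 (entropy_gen s) t <= hellinger_profile t.
Proof.
move=> s0 s1 t0 t1; rewrite -subr_ge0.
apply: (@ge0_of_derive2_ge0 R
  (fun t => hellinger_profile t - even_about1 (entropy_gen s) t)
  (fun t => t / Num.sqrt (1 - t ^+ 2) - odd_about1 (entropy_gen_deriv s) t)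
  (fun t => Num.sqrt (1 - t ^+ 2) ^- 3
            - even_about1 (fun x => x `^ (- s - 1)) t)) => //.
- move=> u u0 u1; apply: is_deriveB.
    by apply: is_derive_hellinger_profile; lra.
  apply: is_derive_even_about1; [exact: is_derive_entropy_gen|lra|lra].
- move=> u u0 u1; apply: is_deriveB.
    by apply: is_derive2_hellinger_profile; lra.
  apply: is_derive_odd_about1; [exact: is_derive2_entropy_gen|lra|lra].
- rewrite /hellinger_profile /even_about1 expr0n subr0 addr0.
  by rewrite entropy_gen_at1 sqrtr1; lra.
- by rewrite /odd_about1 subr0 addr0 subrr !mul0r subrr.
- by move=> u u0 u1; rewrite subr_ge0 even_powR_le//; lra.
Qed.

Lemma hellinger_le_entropy_profile {R : realType} (s t : R) :
  2^-1 <= s -> 0 <= t -> t < 1 ->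
  hellinger_profile t <= even_about1 (entropy_gen s) t.
Proof.
move=> s0 t0 t1; rewrite -subr_ge0.
apply: (@ge0_of_derive2_ge0 R
  (fun t => even_about1 (entropy_gen s) t - hellinger_profile t)
  (fun t => odd_about1 (entropy_gen_deriv s) t - t / Num.sqrt (1 - t ^+ 2))
  (fun t => even_about1 (fun x => x `^ (- s - 1)) t
            - Num.sqrt (1 - t ^+ 2) ^- 3)) => //.
- move=> u u0 u1; apply: is_deriveB; last first.
    by apply: is_derive_hellinger_profile; lra.
  apply: is_derive_even_about1; [exact: is_derive_entropy_gen|lra|lra].
- move=> u u0 u1; apply: is_deriveB; last first.
    by apply: is_derive2_hellinger_profile; lra.
  apply: is_derive_odd_about1; [exact: is_derive2_entropy_gen|lra|lra].
- rewrite /hellinger_profile /even_about1 expr0n subr0 addr0.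
  by rewrite entropy_gen_at1 sqrtr1; lra.
- by rewrite /odd_about1 subr0 addr0 subrr !mul0r subrr.
- move=> u u0 u1; rewrite subr_ge0.
  by rewrite -opprD even_powR_ge//; lra.
Qed.

Lemma even_about1N {R : realType} (f : R -> R) (t : R) :
  even_about1 f (- t) = even_about1 f t.
Proof. by rewrite /even_about1 opprK addrC. Qed.

Lemma hellinger_profileN {R : realType} (t : R) :
  hellinger_profile (- t) = hellinger_profile t.
Proof. by rewrite /hellinger_profile sqrrN. Qed.

(** * Reduction of the discriminations to the profiles *)

Definition mean {R : realType} (p q : R) : R := (p + q) / 2.

Definition skew {R : realType} (p q : R) : R := (p - q) / (p + q).

Lemma skewC {R : realType} (p q : R) : skew q p = - skew p q.
Proof. by rewrite /skew -mulNr opprB [p + q]addrC. Qed.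

Lemma skew_bounds {R : realType} (p q : R) : 0 < p -> 0 < q -> q <= p ->
  0 <= skew p q /\ skew p q < 1.
Proof.
move=> p0 q0 qp; rewrite /skew; split; first by apply: divr_ge0; lra.
by rewrite ltr_pdivrMr; lra.
Qed.

Lemma one_plus_skew {R : realType} (p q : R) : 0 < p -> 0 < q ->
  1 + skew p q = p / mean p q.
Proof. by move=> p0 q0; rewrite /skew /mean; field; lra. Qed.

Lemma one_minus_skew {R : realType} (p q : R) : 0 < p -> 0 < q ->
  1 - skew p q = q / mean p q.
Proof. by move=> p0 q0; rewrite /skew /mean; field; lra. Qed.

Lemma mean_hellinger_profile {R : realType} (p q : R) : 0 < p -> 0 < q ->
  mean p q * hellinger_profile (skew p q) =
  2^-1 * (Num.sqrt p - Num.sqrt q) ^+ 2.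
Proof.
move=> p0 q0; have m0 : 0 < mean p q by rewrite /mean; lra.
have e : 1 - skew p q ^+ 2 = p * q / mean p q ^+ 2.
  by rewrite /skew /mean; field; lra.
rewrite /hellinger_profile e sqrtrM ?mulr_ge0 ?ltW// sqrtrV ?exprn_ge0 ?ltW//.
rewrite sqrtr_sqr gtr0_norm// sqrtrM ?ltW//.
rewrite sqrrB !sqr_sqrtr ?ltW// mulrBr mulr1 mulrCA mulfV ?gt_eqF// mulr1.
by rewrite /mean; field.
Qed.

Lemma mean_entropy_profile {R : realType} (s p q : R) : 0 < p -> 0 < q ->
  mean p q * even_about1 (entropy_gen s) (skew p q) =
  if s == 0 then
    2^-1 * (p * ln (2 * p / (p + q)) + q * ln (2 * q / (p + q)))
  else if s == 1 then
    (p + q) / 2 * ln ((p + q) / (2 * Num.sqrt (p * q)))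
  else (s * (s - 1))^-1
    * ((p `^ (1 - s) + q `^ (1 - s)) / 2 * ((p + q) / 2) `^ s - (p + q) / 2).
Proof.
move=> p0 q0; have m0 : 0 < mean p q by rewrite /mean; lra.
rewrite /even_about1 one_plus_skew// one_minus_skew// /entropy_gen.
have [s0|s0] := eqVneq s 0.
  have em x : 2 * x / (p + q) = x / mean p q by rewrite /mean; field; lra.
  by rewrite !em; field; rewrite gt_eqF.
have [s1|s1] := eqVneq s 1.
  rewrite -/(mean p q); congr (_ * _).
  have r0 : 0 < Num.sqrt (p * q) by rewrite sqrtr_gt0 mulr_gt0.
  have -> : (p + q) / (2 * Num.sqrt (p * q)) = mean p q / Num.sqrt (p * q).
    by rewrite /mean; field; rewrite gt_eqF.
  rewrite -(powR12_sqrt (ltW (mulr_gt0 p0 q0))) in r0 *.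
  (* the mean is itself a quotient, which ln_div would split *)
  move: (mean p q) m0 => m m0.
  by rewrite !ln_div ?posrE// ln_powR lnM ?posrE//; field.
rewrite -/(mean p q).
have e x : 0 < x -> (x / mean p q) `^ (1 - s) * mean p q
    = x `^ (1 - s) * mean p q `^ s.
  move=> x0; rewrite powRM ?invr_ge0 ?ltW// -mulrA; congr (_ * _).
  rewrite -(powR_inv1 (ltW m0)) -powRrM mulN1r opprB.
  have m_neq0 : mean p q != 0 by rewrite gt_eqF.
  by rewrite powRB ?m_neq0 ?implybT// (powRr1 (ltW m0)) divfK.
have := e _ p0; have := e _ q0.
have s1' : s - 1 != 0 by rewrite subr_eq0.
move=> eq ep.
transitivity ((s * (s - 1))^-1 * (((p / mean p q) `^ (1 - s) * mean p q
  + (q / mean p q) `^ (1 - s) * mean p q) / 2 - mean p q)).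
  by field; rewrite s0 s1'.
by rewrite ep eq; congr (_ * (_ - _)); ring.
Qed.

(** For [s] other than [0] and [1], the constant [1] in [W] is distributed over
    the indices as the sum of the means. *)
Lemma W_as_sum {R : realType} (n : nat) (s : R) (P Q : 'I_n -> R) :
  Gamma P -> Gamma Q ->
  W s P Q =
  \sum_(i < n) mean (P i) (Q i) * even_about1 (entropy_gen s) (skew (P i) (Q i)).
Proof.
move=> [P0 P1] [Q0 Q1]; rewrite /W.
under [RHS]eq_bigr do rewrite mean_entropy_profile//.
case: eqP => _; first by rewrite -big_split/= mulr_sumr.
case: eqP => _ //.
rewrite -mulr_sumr sumrB -mulr_suml big_split/= P1 Q1; congr (_ * (_ - _)).
by field.
Qed.

Lemma hellinger_as_sum {R : realType} (n : nat) (P Q : 'I_n -> R) :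
  Gamma P -> Gamma Q ->
  hellinger P Q =
  \sum_(i < n) mean (P i) (Q i) * hellinger_profile (skew (P i) (Q i)).
Proof.
move=> [P0 _] [Q0 _]; rewrite /hellinger mulr_sumr.
by apply: eq_bigr => i _; rewrite mean_hellinger_profile.
Qed.

(** Symmetry in [p] and [q]: an even property of the skew only has to be
    checked on nonnegative values. *)
Lemma skew_ind {R : realType} (K : R -> Prop) :
  (forall t, K t -> K (- t)) -> (forall t, 0 <= t -> t < 1 -> K t) ->
  forall p q, 0 < p -> 0 < q -> K (skew p q).
Proof.
move=> KN Kpos p q p0 q0.
have [qp|/ltW pq] := leP q p.
  by have [] := skew_bounds _ _ p0 q0 qp; exact: Kpos.
rewrite skewC; apply: KN.
by have [] := skew_bounds _ _ q0 p0 pq; exact: Kpos.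
Qed.

Theorem mainTheorem10 (R : realType) (n : nat) (hn : (2 <= n)%N)
    (P Q : 'I_n -> R) (hP : Gamma P) (hQ : Gamma Q) :
  (forall s : R, -2 <= s -> s <= 0 -> W s P Q <= hellinger P Q) /\
  (forall s : R, 2^-1 <= s -> hellinger P Q <= W s P Q).
Proof.
have [[P0 _] [Q0 _]] := (hP, hQ).
have m0 i : 0 <= mean (P i) (Q i) by rewrite divr_ge0// addr_ge0// ltW.
split=> [s s_ge s_le|s s_ge]; rewrite W_as_sum// hellinger_as_sum//;
    apply: ler_sum => i _; apply: ler_wpM2l => //.
- apply: (skew_ind (fun t =>
    even_about1 (entropy_gen s) t <= hellinger_profile t)) => // t.
    by rewrite hellinger_profileN even_about1N.
  exact: entropy_profile_le_hellinger.
- apply: (skew_ind (fun t =>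
    hellinger_profile t <= even_about1 (entropy_gen s) t)) => // t.
    by rewrite hellinger_profileN even_about1N.
  exact: hellinger_le_entropy_profile.
Qed.
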